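(* Let $X$ and $Y$ be independent random variables with distribution function $F$ on $(\mathbb{R},\mathcal{B})$, and let $\psi$ be a measurable function on $(\mathbb{R},\mathcal{B})$, not identically $0$. Furthermore, let $p>1$ and let $\alpha\in[0,1]$ be the unique root of $$E\left(|\psi(Y)|\right)\left[p-1+\alpha\right]-p\left\{E\left(|\psi(Y)|^p\right)\right\}^{1/p}\alpha^{1/p}=0.$$ Then $$\left\{E\left(\left|\frac{E\left(\psi(Y)\mathbf{1}_{[Y\le X]}\mid X\right)}{F(X)}\right|^p\right)\right\}^{1/p}\le\frac{p}{p-1+\alpha}\left\{E\left(|\psi(Y)|^p\right)\right\}^{1/p}$$ holds.
   Context: $\mathcal{B}$ is the Borel $\sigma$-algebra on $\mathbb{R}$; $X$ and $Y$ are real-valued and both have the distribution function $F(x)=P(X\le x)=P(Y\le x)$, which is arbitrary (atoms are allowed); $\psi$ is real-valued; $\mathbf{1}_{[\cdot]}$ denotes an indicator; and $E(\cdot\mid X)$ denotes conditional expectation given $X$. The inequality is trivial if $\psi$ is not $p$-integrable, i.e. if $E(|\psi(Y)|^p)=\infty$. *)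

(* Defs.v *)
From HB Require Import structures.
From mathcomp Require Import all_boot all_order all_algebra.
From mathcomp Require Import all_classical all_reals all_analysis.

Set Implicit Arguments.
Unset Strict Implicit.
Unset Printing Implicit Defensive.

Import Order.TTheory GRing.Theory Num.Theory.
Import numFieldNormedType.Exports.

Local Open Scope classical_set_scope.
Local Open Scope ring_scope.
Local Open Scope ereal_scope.

Section defs.
Context d (T : measurableType d) (R : realType) (P : probability T R).

Definition independent_RV (X Y : {RV P >-> R}) : Prop :=
  forall A B : set R, measurable A -> measurable B ->
    P (X @^-1` A `&` Y @^-1` B) = P (X @^-1` A) * P (Y @^-1` B).

(* [W] is a version of E(Z | X), for an integrable [Z].  The sets of
   [g_sigma_algebra_preimage X] are the events {X \in B} with [B] Borel. *)
Definition is_condexp (X : {RV P >-> R}) (Z W : T -> R) : Prop :=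
  [/\ measurable_fun [set: g_sigma_algebra_preimageType X] W,
      P.-integrable [set: T] (EFin \o W) &
      forall A : set T, g_sigma_algebra_preimage X A ->
        \int[P]_(w in A) (W w)%:E = \int[P]_(w in A) (Z w)%:E].

(* The equation is meant for [Z] with a finite p-th absolute moment; otherwise
   it involves infinite quantities. *)
Definition is_alpha (p : R) (Z : T -> R) (alpha : R) : Prop :=
  (0 <= alpha <= 1)%R /\
  'E_P[(fun w => `|Z w|%R)] * (p - 1 + alpha)%:E
    - p%:E * ('E_P[(fun w => `|Z w| `^ p)%R]) `^ p^-1 * (alpha `^ p^-1)%:E = 0.

End defs.

(* Main.v *)
Require Import Defs.
From HB Require Import structures.
From mathcomp Require Import all_boot all_order all_algebra.
From mathcomp Require Import all_classical all_reals all_analysis.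
From mathcomp Require Import measurable_realfun ring lra.

Set Implicit Arguments.
Unset Strict Implicit.
Unset Printing Implicit Defensive.

Import Order.TTheory GRing.Theory Num.Theory.
Import numFieldNormedType.Exports.

Local Open Scope classical_set_scope.
Local Open Scope ring_scope.
Local Open Scope ereal_scope.

(* With g = |psi|, law mu, Phi x = int_{]-oo, x]} g dmu, F the distribution
   function, and H = Phi / F, the function (Phi, F) |-> Phi^p F^(1-p) is convex
   and equals H^p F along the curve (Phi x, F x).  Bounding its increments by
   its tangent planes and then using Young's inequality with a weight c < 1
   gives, over a grid of mesh tending to 0,
     (p - 1) (1 - c) int H^p dmu + (int g dmu)^p <= c^(1-p) int g^p dmu.
   The tangent is taken at the right endpoint of each cell, so atoms are
   harmless.  The choice c = (p - 1 + alpha) / p gives the constant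
   p / (p - 1 + alpha) when alpha < 1; for alpha = 1 one lets c tend to 1.
   By independence, |E(psi(Y) 1[Y <= X] | X)| <= Phi(X) almost surely. *)

(** * Tangent and Young inequalities for real powers *)

Section young.
Local Open Scope ring_scope.
Context {R : realType}.
Implicit Types p u v c s t : R.

(** The graph of x^p lies above its tangent at [u]. This is Young's inequality for [v] and u^(p-1)
    with exponents p and p/(p-1), multiplied by p. *)
Lemma young_tangent p u v : 1 < p -> 0 <= u -> 0 <= v ->
  p * u `^ (p - 1) * v <= v `^ p + (p - 1) * u `^ p.
Proof.
move=> p1 u0 v0; have p0 : 0 < p by lra.
have pn0 : p != 0 by rewrite gt_eqF.
have p1n0 : p - 1 != 0 by rewrite gt_eqF ?subr_gt0.
have q0 : 0 < p / (p - 1) by rewrite divr_gt0 ?subr_gt0.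
have pq : p^-1 + (p / (p - 1))^-1 = 1.
  by field; rewrite ?pn0 ?p1n0.
have := conjugate_powR v0 (powR_ge0 u (p - 1)) p0 q0 pq.
rewrite -powRrM mulrCA mulfV// mulr1.
rewrite -(ler_pM2l p0) mulrDr (mulrCA p (v `^ p)) mulfV// mulr1 => h.
rewrite -mulrA [_ * v]mulrC; apply: (le_trans h); rewrite lerD2l.
by rewrite invf_div [u `^ p * _]mulrC mulrA (mulrCA p) mulfV// mulr1.
Qed.

Lemma powRB1M c p : 0 < c -> c `^ (1 - p) * c `^ p = c.
Proof.
by move=> c0; rewrite -powRD ?(gt_eqF c0) ?implybT// subrK powRr1// ltW.
Qed.

Lemma powRK p u : 0 < p -> 0 <= u -> (u `^ p) `^ p^-1 = u.
Proof. by move=> p0 u0; rewrite -powRrM mulfV ?gt_eqF// powRr1. Qed.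

Lemma powRVK p u : 0 < p -> 0 <= u -> (u `^ p^-1) `^ p = u.
Proof. by move=> p0 u0; rewrite -powRrM mulVf ?gt_eqF// powRr1. Qed.

(** Comes from [young_tangent] at [c * u], multiplied by c^(1-p). The weight shrinks the coefficient
    of u^p to (p-1)c, so that part of a term (p-1)u^p survives when [c < 1]. *)
Lemma young_tangent_scaled p c u v : 1 < p -> 0 < c -> 0 <= u -> 0 <= v ->
  p * u `^ (p - 1) * v <= c `^ (1 - p) * v `^ p + (p - 1) * c * u `^ p.
Proof.
move=> p1 c0 u0 v0; have cu0 : 0 <= c * u by rewrite mulr_ge0// ltW.
have c1 : c `^ (1 - p) * c `^ (p - 1) = 1.
  by rewrite -powRD ?(gt_eqF c0) ?implybT// addrA subrK subrr powRr0.
have := young_tangent p1 cu0 v0.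
rewrite !powRM ?(ltW c0)// -(ler_pM2l (powR_gt0 (1 - p) c0)) => h.
apply: (le_trans _ (le_trans h _)); rewrite le_eqVlt; apply/orP; left;
  apply/eqP.
  by rewrite -[LHS]mul1r -[X in X * _]c1; ring.
by rewrite -[X in _ = _ + _ * X * _](powRB1M p c0); ring.
Qed.

(* Convexity of the perspective (Phi, F) |-> Phi^p F^(1-p), in the
   coordinates Phi = h F; the right-hand side is a tangent plane at
   (h1 F1, F1). *)
Lemma perspective_convex p h0 h1 F0 F1 : 1 < p -> 0 <= h0 -> 0 <= h1 ->
  0 <= F0 ->
  h1 `^ p * F1 <= h0 `^ p * F0 + p * h1 `^ (p - 1) * (h1 * F1 - h0 * F0)
                  - (p - 1) * h1 `^ p * (F1 - F0).
Proof.
move=> p1 h00 h10 F00; have p0 : 0 < p by lra.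
(* [F1] cancels in the claim. What remains is the tangent inequality for x^p at [h1], evaluated at
   [h0] and weighted by [F0]. *)
have := ler_wpM2r F00 (young_tangent p1 h10 h00).
rewrite -(mulr_powRB1 h10 p0); set a := _ `^ (p - 1); nra.
Qed.

(** The tangent at 1; it serves the limiting case [alpha = 1] of [hardy_constant]. *)
Lemma bernoulli_powR p c : 1 < p -> 0 <= c -> 1 + p * (c - 1) <= c `^ p.
Proof.
move=> p1 c0; have := young_tangent p1 (@ler01 R) c0.
by rewrite !powR1 mulr1; lra.
Qed.

(** The slope of x^p is below p on [0, 1[. The strictness is what makes the root [alpha] unique. *)
Lemma powR_sub_lt p s t : 1 < p -> 0 <= s -> s < t -> t <= 1 ->
  t `^ p - s `^ p < p * (t - s).
Proof.
move=> p1 s0 st t1; have p0 : 0 < p by lra.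
have chord a b : 0 <= a -> a < b -> b <= 1 ->
    b `^ p - a `^ p <= p * b `^ (p - 1) * (b - a).
  move=> a0 ab b1; have b0 : 0 <= b by lra.
  have := young_tangent p1 b0 a0; rewrite -(mulr_powRB1 b0 p0).
  set x := _ `^ (p - 1); nra.
(* For [t = 1] the tangent at the right end has slope exactly p. Strictness therefore comes from the
   left half, whose right end [m] is below 1. *)
pose m := (s + t) / 2.
have [sm mt] : s < m /\ m < t by rewrite /m; split; lra.
have E1 : 1 `^ (p - 1) = 1 :> R by rewrite powR1.
have m1 : m `^ (p - 1) < 1.
  by rewrite -[ltRHS]E1 gt0_ltr_powR ?nnegrE ?subr_gt0//; lra.
have t1' : t `^ (p - 1) <= 1.
  by rewrite -[leRHS]E1 ge0_ler_powR ?nnegrE ?subr_ge0//; lra.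
have h1 : m `^ p - s `^ p < p * (m - s).
  apply: (le_lt_trans (chord s m _ _ _)) => //; first by lra.
  by rewrite -mulrA ltr_pM2l// gtr_pMl ?subr_gt0.
have h2 : t `^ p - m `^ p <= p * (t - m).
  apply: (le_trans (chord m t _ _ _)) => //; first by lra.
  by rewrite -mulrA ler_pM2l// ger_pMl ?subr_gt0.
by lra.
Qed.

End young.

(** * Distribution function and partial mean of a law on the line *)

Section distribution_function.
Context {R : realType} (mu : probability R R).
Implicit Types (g : R -> R) (D : set R).

(** The F of the overview, real-valued so that one can divide by it; [partial_mean] is Phi. *)
Definition dfun (x : R) : R := fine (mu `]-oo, x]%classic).

Definition partial_mean g (x : R) : R := (\int[mu]_(y in `]-oo, x]) g y)%R.

Lemma dfun_ge0 x : (0 <= dfun x)%R.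
Proof. exact: fine_ge0. Qed.

Lemma dfun_le1 x : (dfun x <= 1)%R.
Proof. by rewrite -lee_fin fineK ?fin_num_measure// probability_le1. Qed.

Lemma itvNyU (s t : R) : (s <= t)%R ->
  `]-oo, t]%classic = `]-oo, s] `|` `]s, t].
Proof. by move=> st; rewrite -itv_bndbnd_setU. Qed.

Lemma itvNy_disj (s t : R) : [disjoint `]-oo, s]%classic & `]s, t]%classic].
Proof.
by apply: lt_disjoint => x y; rewrite !in_itv/= => xs /andP[/(le_lt_trans xs)].
Qed.

Lemma dfunB s t : (s <= t)%R -> (dfun t - dfun s)%R = fine (mu `]s, t]%classic).
Proof.
move=> st; rewrite /dfun (itvNyU st) measureU//; last first.
  exact/disj_set2P/itvNy_disj.
by rewrite fineD ?fin_num_measure// addrAC subrr add0r.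
Qed.

Lemma dfun_nd : {homo dfun : s t / (s <= t)%R}.
Proof. by move=> s t st; rewrite -subr_ge0 dfunB// fine_ge0. Qed.

Section integrable.
Context (g : R -> R) (ig : mu.-integrable setT (EFin \o g)).

Let ig' D : measurable D -> mu.-integrable D (EFin \o g).
Proof. by move=> mD; apply: integrableS ig. Qed.

Lemma partial_meanB s t : (s <= t)%R ->
  (partial_mean g t - partial_mean g s)%R = (\int[mu]_(y in `]s, t]) g y)%R.
Proof.
move=> st; rewrite /partial_mean (itvNyU st) Rintegral_setU//.
- by rewrite addrAC subrr add0r.
- by apply: ig'; exact: measurableU.
- exact: itvNy_disj.
Qed.

Lemma partial_mean_eq0 x : dfun x = 0%R -> partial_mean g x = 0%R.
Proof.
move=> Fx0; rewrite /partial_mean /Rintegral null_set_integral//.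
- exact: measurable_int (ig' _).
- by rewrite -[LHS]fineK ?fin_num_measure//; congr EFin.
Qed.

(** Where F vanishes, so does Phi. With the convention that division by 0 gives 0, H F = Phi thus
    holds everywhere. *)
Lemma partial_mean_divK x :
  (partial_mean g x / dfun x * dfun x)%R = partial_mean g x.
Proof.
have [F0|F0] := eqVneq (dfun x) 0%R; last by rewrite divfK.
by rewrite (partial_mean_eq0 F0) F0 mulr0.
Qed.

Hypothesis g0 : forall x, (0 <= g x)%R.

Lemma partial_mean_ge0 x : (0 <= partial_mean g x)%R.
Proof. exact: Rintegral_ge0. Qed.

Lemma partial_mean_nd : {homo partial_mean g : s t / (s <= t)%R}.
Proof. by move=> s t st; rewrite -subr_ge0 partial_meanB// Rintegral_ge0. Qed.

End integrable.
End distribution_function.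

(** * Measurability, Fatou and continuity *)

(** The inverse is the power -1, also at 0, where both are 0 by convention. *)
Lemma measurable_funV_ge0 d (T : measurableType d) (R : realType) (f : T -> R) :
  measurable_fun setT f -> (forall x, (0 <= f x)%R) ->
  measurable_fun setT (fun x => (f x)^-1)%R.
Proof.
move=> mf f0; rewrite (_ : (fun x => _) = (fun x => f x `^ (-1))%R); last first.
  by apply/funext => x; rewrite powR_inv1.
exact: (measurableT_comp (measurable_powR _) mf).
Qed.

(** Fatou's lemma for a convergent sequence, whose lower limit is its limit. The bound is asked only
    for large n, since the grids below give it only from some index on. *)
Lemma fatou_le d (T : measurableType d) (R : realType)
    (mu : {measure set T -> \bar R}) (f_ : (T -> \bar R)^nat) (f : T -> \bar R)
    (b : \bar R) :
  (forall n, measurable_fun setT (f_ n)) -> (forall n x, 0 <= f_ n x) ->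
  (forall x, f_ n x @[n --> \oo] --> f x) ->
  (\forall n \near \oo, \int[mu]_x f_ n x <= b) ->
  \int[mu]_x f x <= b.
Proof.
move=> mf f0 ff fb.
rewrite (eq_integral (fun x => limn_einf (f_^~ x))); last first.
  by move=> x _; rewrite (cvg_limn_einf_sup (ff x)).1.
apply: (le_trans (fatou mu measurableT mf _)) => //.
rewrite limn_einf_lim; apply: lime_le; first exact: is_cvg_einfs.
apply: filterS fb => n; apply: le_trans.
by apply: ereal_inf_lbound; exists n => /=.
Qed.

(** Continuity of the measure from above: ]-oo, x] is the intersection of the ]-oo, x + 1/(n+1)]. *)
Lemma dfun_cvg_right (R : realType) (mu : probability R R) (x : R) :
  (dfun mu (x + n.+1%:R^-1) @[n --> \oo] --> dfun mu x)%R.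
Proof.
apply: fine_cvg; rewrite fineK ?fin_num_measure//.
rewrite [X in _ --> mu X](@itvNycEbigcap R false).
apply: nonincreasing_cvg_mu => [| | |m n mn].
- by rewrite -ge0_fin_numE// fin_num_measure.
- by move=> ?; exact: measurable_itv.
- by apply: bigcap_measurable => // ? _; exact: measurable_itv.
- apply/subsetPset; apply: subset_itvl.
  by rewrite bnd_simp lerD2l lef_pV2 ?posrE// ler_nat.
Qed.

Lemma powR_continuous (R : realType) (p l : R) : (0 < l)%R ->
  {for l, continuous (fun x => x `^ p)%R}.
Proof.
move=> l0; apply: differentiable_continuous; apply/derivable1_diffP.
by apply: derivable_powR; rewrite in_itv/= l0.
Qed.

(** * Domination, integrated Young inequality and Jensen *)

Section powR_integrable.
Context {R : realType} (mu : probability R R) (g : R -> R) (p : R).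
Hypotheses (p1 : (1 < p)%R) (mg : measurable_fun setT g).
Hypotheses (g0 : forall x, (0 <= g x)%R).
Hypothesis igp : mu.-integrable setT (EFin \o (fun x => g x `^ p)%R).

(** The tangent at 1 gives p g <= g^p + p - 1, hence g <= g^p + 1, and constants are integrable for
    a probability. *)
Lemma integrable_of_powR : mu.-integrable setT (EFin \o g).
Proof.
apply: (@le_integrable _ _ _ mu _ measurableT _
  (EFin \o (fun x => g x `^ p + 1)%R)).
- exact/measurable_EFinP.
- move=> x _ /=; rewrite lee_fin ger0_norm// ger0_norm ?addr_ge0 ?powR_ge0//.
  have := young_tangent p1 (@ler01 R) (g0 x); rewrite !powR1.
  have := powR_ge0 (g x) p; have := p1; have := g0 x; nra.
- exact: (integrableD measurableT igp
    (finite_measure_integrable_cst mu 1%R measurableT)).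
Qed.

Let ig := integrable_of_powR.

(** [young_tangent_scaled] with [v = g y], integrated over y in [A] for constant [u]. *)
Lemma young_Rintegral c A u : (0 < c)%R -> measurable A -> (0 <= u)%R ->
  (p * u `^ (p - 1) * (\int[mu]_(y in A) g y) <=
   c `^ (1 - p) * (\int[mu]_(y in A) (g y `^ p))
   + (p - 1) * c * u `^ p * fine (mu A))%R.
Proof.
move=> c0 mA u0.
rewrite -Rintegral_cst// -!RintegralZl//; last 2 first.
- exact: integrableS igp.
- exact: integrableS ig.
have iC : mu.-integrable A (EFin \o (fun y => c `^ (1 - p) * g y `^ p)%R).
  exact: integrableZl (integrableS _ _ _ igp).
have ik : mu.-integrable A (EFin \o cst ((p - 1) * c * u `^ p)%R).
  exact: finite_measure_integrable_cst.
rewrite -RintegralD//; apply: le_Rintegral => //.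
- exact: integrableZl (integrableS _ _ _ ig).
- exact: (integrableD mA iC ik).
- by move=> y _; apply: young_tangent_scaled.
Qed.

(** Jensen's inequality, from the tangent at the mean: [c = 1], [A] the whole line, [u] the mean of
    g. *)
Lemma powR_Rintegral_le : ((\int[mu]_y g y) `^ p <= \int[mu]_y (g y `^ p))%R.
Proof.
have a0 : (0 <= \int[mu]_y g y)%R by exact: Rintegral_ge0.
have p0 : (0 < p)%R by have := p1; lra.
have := young_Rintegral (@ltr01 R) measurableT a0.
rewrite probability_setT powR1 mul1r !mulr1 -mulrA
  [(_ * \int[_]_(_ in _) _)%R]mulrC.
by rewrite mulr_powRB1//; lra.
Qed.

End powR_integrable.

(** * The weighted inequality for H = Phi / F, over a grid *)

Section averaged_hardy.
Context {R : realType} (mu : probability R R) (g : R -> R) (p c : R).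
Hypotheses (p1 : (1 < p)%R) (c0 : (0 < c)%R) (c1 : (c < 1)%R).
Hypotheses (mg : measurable_fun setT g) (g0 : forall x, (0 <= g x)%R).
Hypothesis igp : mu.-integrable setT (EFin \o (fun x => g x `^ p)%R).

Let F := dfun mu.
Let Phi := partial_mean mu g.
Let H x := (Phi x / F x)%R.
Let G x := (H x `^ p * F x)%R.
(** The tangent plane supplies -(p-1) H^p and Young's inequality gives back (p-1)c H^p; [D] is the
    difference, positive because [c < 1]. *)
Let D := ((p - 1) * (1 - c))%R.
Let C := (c `^ (1 - p))%R.

Let D0 : (0 < D)%R.
Proof. by rewrite /D mulr_gt0 ?subr_gt0. Qed.

Let ig := integrable_of_powR p1 mg g0 igp.

Let igD A : measurable A -> mu.-integrable A (EFin \o g).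
Proof. by move=> mA; apply: integrableS ig. Qed.

Let igpD A : measurable A -> mu.-integrable A (EFin \o (fun x => g x `^ p)%R).
Proof. by move=> mA; apply: integrableS igp. Qed.

Let H0 x : (0 <= H x)%R.
Proof. by rewrite divr_ge0 ?dfun_ge0 ?partial_mean_ge0. Qed.

Let HF x : (H x * F x = Phi x)%R. Proof. exact: partial_mean_divK. Qed.

Let G0 x : (0 <= G x)%R.
Proof. by rewrite mulr_ge0 ?powR_ge0 ?dfun_ge0. Qed.

(** One cell: the tangent plane at the right end [t] bounds the increment of [G], and Young's
    inequality over ]s, t] with [u = H t] bounds its term in g. *)
Let step s t : (s <= t)%R ->
  (G t + D * H t `^ p * fine (mu `]s, t]%classic) <=
   G s + C * \int[mu]_(y in `]s, t]) (g y `^ p))%R.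
Proof.
move=> st; have := perspective_convex (F t) p1 (H0 s) (H0 t) (dfun_ge0 mu s).
rewrite !HF partial_meanB// dfunB//.
have := young_Rintegral p1 mg g0 igp c0 (measurable_itv `]s, t]) (H0 t).
rewrite -/C /G /D; set a := (H t `^ p)%R; set m := fine _.
by rewrite /F; lra.
Qed.

(** The half-line left of the grid: the argument of [step] with Phi = F = 0 at the left end. The
    nonnegative term D G(s) is dropped. *)
Let step0 s : (G s <= C * \int[mu]_(y in `]-oo, s]) (g y `^ p))%R.
Proof.
have := perspective_convex (F s) p1 (lexx 0%R) (H0 s) (lexx 0%R).
rewrite !mulr0 !subr0 add0r HF.
have := young_Rintegral p1 mg g0 igp c0 (measurable_itv `]-oo, s]) (H0 s).
have := mulr_ge0 (ltW D0) (G0 s).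
rewrite -/C -/(F s) -/(dfun mu s) -/(partial_mean mu g s) /G /D -/F -/Phi.
by set a := (H s `^ p)%R; lra.
Qed.

(** A quotient of monotone functions, hence measurable. It tends to H as [e] decreases to 0, by
    right continuity of F. *)
Let shifted e x := (Phi x / F (x + e))%R.

Let shifted_ge0 e x : (0 <= shifted e x)%R.
Proof. by rewrite divr_ge0 ?dfun_ge0 ?partial_mean_ge0. Qed.

Let mshifted e : measurable_fun setT (fun x => (shifted e x `^ p)%:E).
Proof.
apply/measurable_EFinP; apply: (measurableT_comp (measurable_powR p)).
apply: measurable_funM.
  by apply: nondecreasing_measurable => // s t; apply: partial_mean_nd.
apply: measurable_funV_ge0 => [|x]; last exact: dfun_ge0.
by apply: nondecreasing_measurable => // s t st; apply: dfun_nd; rewrite lerD2r.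
Qed.

(* On a cell ]s, t] of length at most e, [shifted e] is a lower bound of the
   step function H(t), so no rounding to the grid has to be defined. *)
Let shifted_le e s t x : (s < x)%R -> (x <= t)%R -> (t <= s + e)%R ->
  (shifted e x <= H t)%R.
Proof.
move=> sx xt te; rewrite /shifted.
have Px : (Phi x <= Phi t)%R by apply: partial_mean_nd.
have Px0 : (0 <= Phi x)%R by apply: partial_mean_ge0.
have [Ft0|Ft0] := eqVneq (F t) 0%R.
  have Pt0 : Phi t = 0%R by apply: partial_mean_eq0.
  by have -> : Phi x = 0%R; [lra|rewrite mul0r].
have Ft : (0 < F t)%R by rewrite lt_neqAle eq_sym Ft0 dfun_ge0.
have Fe : (F t <= F (x + e))%R by apply: dfun_nd; lra.
apply: ler_pM => //; rewrite ?invr_ge0 ?dfun_ge0//.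
by rewrite lef_pV2// posrE (lt_le_trans Ft).
Qed.

(** Telescoping of [step] over [k] cells of length [e] from [a], started by [step0] on ]-oo, a]. *)
Let grid e a k : (0 < e)%R -> let b := (a + k%:R * e)%R in
  (G b)%:E + D%:E * (\int[mu]_(x in `]a, b]) (shifted e x `^ p)%:E) <=
  (C * \int[mu]_(y in `]-oo, b]) (g y `^ p))%:E.
Proof.
move=> e0; elim: k => [|k IH] /=.
  rewrite mul0r addr0 set_itvoc0 integral_set0 mule0 adde0 lee_fin.
  exact: step0.
set b := (a + k%:R * e)%R in IH *; set b' := (a + k.+1%:R * e)%R.
have b'E : b' = (b + e)%R by rewrite /b' /b -natr1 mulrDl mul1r addrA.
have bb' : (b <= b')%R by lra.
have ab : (a <= b)%R by rewrite /b lerDl mulr_ge0// ltW.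
have -> : `]a, b']%classic = `]a, b] `|` `]b, b'].
  by rewrite -itv_bndbnd_setU.
rewrite ge0_integral_setU//=; last 3 first.
- exact: measurable_funTS.
- by move=> x _; rewrite lee_fin powR_ge0.
- apply: lt_disjoint => x y; rewrite !in_itv/= => /andP[_ xs] /andP[].
  by move=> /(le_lt_trans xs).
rewrite (itvNyU bb') Rintegral_setU//; last 2 first.
- by apply: igpD; exact: measurableU.
- exact: itvNy_disj.
have le2 : \int[mu]_(x in `]b, b']) (shifted e x `^ p)%:E <=
    (H b' `^ p * fine (mu `]b, b']%classic))%:E.
  rewrite (_ : _%:E = \int[mu]_(x in `]b, b']) (H b' `^ p)%:E); last first.
    rewrite integral_cst; last exact: measurable_itv.
    by rewrite EFinM fineK// fin_num_measure//; exact: measurable_itv.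
  apply: ge0_le_integral => //.
  - by move=> x _; rewrite lee_fin powR_ge0.
  - exact: measurable_funTS.
  - move=> x; rewrite /= in_itv/= => /andP[bx xb'].
    rewrite lee_fin ge0_ler_powR ?nnegrE//; first by have := p1; lra.
    by apply: (shifted_le bx) => //; rewrite b'E.
have := step bb'; rewrite -lee_fin => st.
rewrite ge0_muleDr ?integral_ge0//; last 2 first.
- by move=> x _; rewrite lee_fin powR_ge0.
- by move=> x _; rewrite lee_fin powR_ge0.
rewrite mulrDr EFinD.
(* On the new cell [le2] replaces the integral by the constant H(b')^p; then [step] applies, and
   finally the induction hypothesis. *)
apply: (@le_trans _ _ (D%:E * \int[mu]_(x in `]a, b]) (shifted e x `^ p)%:E +
  (G b' + D * H b' `^ p * fine (mu `]b, b']%classic))%:E)).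
  rewrite addeCA leeD2l// EFinD leeD2l// -mulrA (EFinM D).
  by rewrite lee_wpmul2l// lee_fin ltW.
apply: (le_trans (leeD2l _ st)).
by rewrite EFinD addeA leeD2r// addeC.
Qed.
(** Where Phi vanishes the sequence is constant. Elsewhere F and H are positive, so inverse and
    power are continuous at the limit. *)
Let shifted_cvg x :
  (shifted n.+1%:R^-1 x `^ p)%:E @[n --> \oo] --> (H x `^ p)%:E.
Proof.
apply: cvg_EFin; first exact: nearW.
have [P0|Px] := eqVneq (Phi x) 0%R.
  rewrite /shifted /comp /= /H P0 mul0r.
  by apply: cvg_near_cst; apply: nearW => n; rewrite /= mul0r.
have Fx : F x != 0%R.
  by apply: contra_neq Px => Fx0; exact: partial_mean_eq0.
apply: (@continuous_cvg _ _ _ _ _ _ (fun x => x `^ p)%R);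
  first apply: powR_continuous.
  by rewrite lt_neqAle H0 andbT eq_sym mulf_neq0// invr_neq0.
by apply: cvgMr; apply: cvgV => //; exact: dfun_cvg_right.
Qed.

(** Since F <= 1 < p, F^p <= F, so Phi^p = H^p F^p <= G. Through this bound the last [G] of the grid
    yields the power of the mean of g. *)
Let PhiG x y : (x <= y)%R -> (Phi x `^ p <= G y)%R.
Proof.
move=> xy; have p0 : (0 < p)%R by have := p1; lra.
apply: (@le_trans _ _ (Phi y `^ p)%R).
  apply: ge0_ler_powR; rewrite ?nnegrE ?(ltW p0) ?partial_mean_ge0//.
  exact: partial_mean_nd.
rewrite -HF powRM ?dfun_ge0// ler_wpM2l ?powR_ge0//.
have [->|Fy] := eqVneq (F y) 0%R; first by rewrite powR0 ?gt_eqF.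
have F01 : (0 < F y <= 1)%R.
  by rewrite lt_neqAle eq_sym Fy dfun_ge0 dfun_le1.
by rewrite ge1r_powR// ltW.
Qed.

Let itv_near x : \forall n \near \oo, (`](- n%:R)%R, n%:R]%classic : set R) x.
Proof.
near=> n; rewrite /= in_itv/=; have xn : (`|x| < n%:R)%R.
  by near: n; exact: nbhs_infty_gtr.
by move: xn; rewrite ltr_norml => /andP[-> /ltW].
Unshelve. all: by end_near. Qed.

(** Grids on ]-n, n] with mesh 1/(n+1), then Fatou. Keeping Phi at a fixed [m <= n] makes the bound
    independent of n. *)
Lemma averaged_hardy_bounded m :
  \int[mu]_x (H x `^ p)%:E <=
  ((C * (\int[mu]_x (g x `^ p)) - Phi m%:R `^ p) / D)%:E.
Proof.
pose f_ n := (fun x => (shifted n.+1%:R^-1 x `^ p)%:E) \_ `](- n%:R)%R, n%:R].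
apply: (@fatou_le _ _ _ mu f_).
- by move=> n; apply/(measurable_restrictT _ _).1 => //;
    exact: measurable_funTS.
- move=> n x; rewrite /f_ patchE; case: ifP => // _.
  by rewrite lee_fin powR_ge0.
- move=> x; have := @shifted_cvg x; apply: cvg_trans; apply: near_eq_cvg.
  by apply: filterS (itv_near x) => n xn; rewrite /f_ patchE mem_set.
exists m => // n /= mn.
rewrite -integral_mkcond.
have e0 : (0 < n.+1%:R^-1 :> R)%R by rewrite invr_gt0.
(* 2n(n+1) cells of length 1/(n+1) lead from -n exactly to n. *)
have /= := grid (- n%:R)%R (2 * n * n.+1) e0.
have -> : (- n%:R + (2 * n * n.+1)%:R * n.+1%:R^-1 = n%:R :> R)%R.
  by rewrite natrM mulfK// natrM; lra.
move=> h; rewrite -(@lee_pmul2l _ D%:E)// -EFinM mulrCA mulfV ?gt_eqF// mulr1.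
rewrite EFinB leeBrDl//.
apply: le_trans (le_trans h _).
  by rewrite leeD2r// lee_fin PhiG// ler_nat.
rewrite lee_fin ler_wpM2l ?powR_ge0//.
rewrite fine_le ?integrable_fin_num//; [exact: igpD|].
apply: ge0_subset_integral => //.
  exact: measurable_int igp.
by move=> x _; rewrite lee_fin powR_ge0.
Qed.

Lemma averaged_hardy :
  D%:E * (\int[mu]_x (H x `^ p)%:E) + ((\int[mu]_x g x) `^ p)%:E <=
  (C * (\int[mu]_x (g x `^ p)))%:E.
Proof.
have p0 : (0 < p)%R by have := p1; lra.
(* The case [m = 0] already gives finiteness, so the rest can be done in the reals. *)
have Ifin : \int[mu]_x (H x `^ p)%:E \is a fin_num.
  rewrite ge0_fin_numE ?(le_lt_trans (averaged_hardy_bounded 0)) ?ltry//.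
  by apply: integral_ge0 => x _; rewrite lee_fin powR_ge0.
rewrite -(fineK Ifin) -EFinM -EFinD lee_fin.
set I := fine _; set B := (C * _)%R.
have le_r m : (Phi m%:R `^ p <= B - D * I)%R.
  have := averaged_hardy_bounded m; rewrite -(fineK Ifin) lee_fin -/I -/B.
  by rewrite ler_pdivlMr//; lra.
have r0 : (0 <= B - D * I)%R by apply: le_trans (le_r 0%N); exact: powR_ge0.
(* It remains to let [m] grow. After taking p-th roots, the bound on every Phi(m) passes to the mean
   of g by Fatou for the restrictions of g to ]-oo, n]. *)
suff gr : (\int[mu]_x g x <= (B - D * I) `^ p^-1)%R.
  suff : ((\int[mu]_x g x) `^ p <= B - D * I)%R by lra.
  rewrite -[leRHS](powRVK p0)//.
  by rewrite ge0_ler_powR ?nnegrE ?powR_ge0 ?(ltW p0) ?Rintegral_ge0.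
rewrite -lee_fin fineK ?integrable_fin_num//.
pose f_ n := (EFin \o g) \_ `]-oo, n%:R].
apply: (@fatou_le _ _ _ mu f_).
- move=> n; apply/(measurable_restrictT _ _).1 => //.
  exact/measurable_funTS/measurable_EFinP.
- by move=> n x; rewrite /f_ patchE; case: ifP => // _; rewrite lee_fin.
- move=> x; apply: cvg_near_cst.
  apply: filterS (itv_near x) => n; rewrite /= in_itv/= => /andP[_ xn].
  by rewrite /f_ patchE mem_set//= in_itv.
apply: nearW => n; rewrite -integral_mkcond.
rewrite (_ : integral _ _ _ = (Phi n%:R)%:E); last first.
  by rewrite fineK//; apply: integrable_fin_num => //; exact: igD.
rewrite lee_fin -[leLHS](powRK p0) ?partial_mean_ge0//.
by apply: ge0_ler_powR; rewrite ?nnegrE ?powR_ge0 ?invr_ge0 ?(ltW p0).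
Qed.

End averaged_hardy.

(** * The constant p / (p - 1 + alpha) *)

Lemma mul_powRV_le (R : realType) (p c i b : R) : (0 < p)%R -> (0 <= c)%R ->
  (0 <= i)%R -> (i * c `^ p <= b)%R -> (c * i `^ p^-1 <= b `^ p^-1)%R.
Proof.
move=> p0 c0 i0 h.
have ci0 : (0 <= c * i `^ p^-1)%R by rewrite mulr_ge0 ?powR_ge0.
rewrite -[leLHS](powRK p0 ci0).
have ip0 : (0 <= i * c `^ p)%R by rewrite mulr_ge0 ?powR_ge0.
apply: ge0_ler_powR; rewrite ?nnegrE ?powR_ge0 ?invr_ge0 ?(ltW p0)//.
  exact: le_trans h.
by rewrite powRM ?powR_ge0// powRVK// mulrC.
Qed.

Section hardy_constant.
Context {R : realType} (mu : probability R R) (g : R -> R) (p alpha : R).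
Hypotheses (p1 : (1 < p)%R) (alpha01 : (0 <= alpha <= 1)%R).
Hypotheses (mg : measurable_fun setT g) (g0 : forall x, (0 <= g x)%R).
Hypothesis igp : mu.-integrable setT (EFin \o (fun x => g x `^ p)%R).

Let a := (\int[mu]_x g x)%R.
Let B := (\int[mu]_x (g x `^ p))%R.
Let b := (B `^ p^-1)%R.
Let I := \int[mu]_x ((partial_mean mu g x / dfun mu x) `^ p)%:E.

Hypothesis alphaE : (a * (p - 1 + alpha) = p * b * alpha `^ p^-1)%R.

Let I0 : 0 <= I.
Proof. by apply: integral_ge0 => x _; rewrite lee_fin powR_ge0. Qed.

Let B0 : (0 <= B)%R.
Proof. by apply: Rintegral_ge0 => x _; rewrite powR_ge0. Qed.

Let a0 : (0 <= a)%R. Proof. exact: Rintegral_ge0. Qed.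

Let Ifin : I \is a fin_num.
Proof.
(* Any weight strictly between 0 and 1 shows finiteness; 1/2 is taken. *)
have h0 : (0 < 2^-1 :> R)%R by lra.
have h1 : (2^-1 < 1 :> R)%R by lra.
have := averaged_hardy p1 h0 h1 mg g0 igp; rewrite -/I -/a -/B => h.
rewrite ge0_fin_numE// ltNge leye_eq; apply/negP => /eqP Iy.
move: h; rewrite Iy gt0_muley; first by rewrite addye// leye_eq.
by rewrite lte_fin mulr_gt0 ?subr_gt0.
Qed.

(** [averaged_hardy] multiplied by c^p, which turns the factor c^(1-p) into c. *)
Let bound c : (0 < c)%R -> (c < 1)%R ->
  ((p - 1) * (1 - c) * fine I * c `^ p + a `^ p * c `^ p <= c * B)%R.
Proof.
move=> c0 c1; have := averaged_hardy p1 c0 c1 mg g0 igp.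
rewrite -/I -/a -/B -(fineK Ifin) -EFinM -EFinD lee_fin => h.
have -> : (c * B = c `^ (1 - p) * B * c `^ p)%R.
  by rewrite mulrAC powRB1M.
by rewrite -mulrDl ler_wpM2r ?powR_ge0.
Qed.

Lemma hardy_constant :
  I `^ p^-1 <= (p / (p - 1 + alpha))%:E * (\int[mu]_x (g x `^ p)%:E) `^ p^-1.
Proof.
have p0 : (0 < p)%R by have := p1; lra.
have [al0 al1] := andP alpha01.
have -> : \int[mu]_x (g x `^ p)%:E = B%:E.
  by rewrite fineK ?integrable_fin_num.
have If0 : (0 <= fine I)%R by exact: fine_ge0.
move: bound; rewrite -(fineK Ifin); move: (fine I) If0 => i i0 ibound.
have {}ibound c : (0 < c)%R -> (c < 1)%R ->
  ((p - 1) * (1 - c) * i * c `^ p + a `^ p * c `^ p <= c * B)%R := ibound c.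
rewrite !poweR_EFin -EFinM lee_fin -/b.
have q0 : (0 < p - 1 + alpha)%R by have := p1; lra.
rewrite mulrAC ler_pdivlMr// mulrC -ler_pdivrMl// mulrA [(p^-1 * _)%R]mulrC.
set c := ((p - 1 + alpha) / p)%R.
have c0 : (0 < c)%R by rewrite divr_gt0.
have cE : (c * p = p - 1 + alpha)%R by rewrite /c divfK// gt_eqF.
have b0 : (0 <= b)%R by rewrite powR_ge0.
(* The equation for [alpha] reads a c = b alpha^(1/p); this is its p-th power. *)
have acE : (a `^ p * c `^ p = B * alpha)%R.
  rewrite -powRM ?(ltW c0)//.
  have -> : (a * c = b * alpha `^ p^-1)%R.
    by rewrite /c mulrA alphaE; field; rewrite gt_eqF.
  by rewrite powRM ?powR_ge0// !powRVK.
have [al|al] := ltP alpha 1%R.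
  have c1 : (c < 1)%R by rewrite /c ltr_pdivrMr// mul1r; lra.
  apply: mul_powRV_le => //; first exact: ltW.
  have ca : (0 < c - alpha)%R.
    rewrite -(pmulr_lgt0 _ p0) mulrC mulrBr [(p * c)%R]mulrC cE.
    have : (0 < (p - 1) * (1 - alpha))%R by rewrite mulr_gt0 ?subr_gt0.
    lra.
  (* As (p-1)(1-c) = c - alpha, the bound becomes (c - alpha) i c^p + alpha B <= c B, that is, i c^p
     <= B after division by c - alpha > 0. *)
  rewrite -(ler_pM2l ca); have := ibound _ c0 c1; rewrite acE.
  have -> : ((p - 1) * (1 - c) = c - alpha)%R by lra.
  by rewrite -mulrA mulrBl; lra.
(* Here [c = 1], which [bound] excludes. The claim is proved by contradiction with a weight
   [t < 1]. *)
have alE : alpha = 1%R by lra.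
have cE1 : c = 1%R by rewrite /c alE subrK mulfV// gt_eqF.
rewrite cE1 mul1r leNgt; apply/negP => bi.
set j := (i `^ p^-1)%R in bi *.
have j0 : (0 < j)%R by exact: le_lt_trans bi.
(* Chosen so that t j is the midpoint of b and j; a bound t j <= b then contradicts b < j. *)
pose t := ((b + j) / (2 * j))%R.
have t0 : (0 < t)%R by rewrite divr_gt0//; lra.
have t1 : (t < 1)%R by rewrite /t ltr_pdivrMr; lra.
have apB : (a `^ p = B)%R by move: acE; rewrite cE1 alE powR1 !mulr1.
suff /(mul_powRV_le p0 (ltW t0) i0) : (i * t `^ p <= B)%R.
  have -> : (t * i `^ p^-1 = (b + j) / 2)%R.
    by rewrite -/j /t; field; rewrite gt_eqF.
  by rewrite -/b; clearbody b; lra.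
have d0 : (0 < (p - 1) * (1 - t))%R by rewrite mulr_gt0 ?subr_gt0.
(* With a^p = B, Bernoulli bounds (t - t^p) B by (p-1)(1-t) B, and the common factor (p-1)(1-t)
   cancels. *)
rewrite -(ler_pM2l d0) mulrA; have := ibound _ t0 t1; rewrite apB.
have := ler_wpM2l B0 (bernoulli_powR p1 (ltW t0)); lra.
Qed.

End hardy_constant.

(** * Equal laws, independence and almost sure comparison *)

(** The rays ]x, +oo[ generate the Borel sets and are stable under intersection; the two measures
    agree on them by complements. *)
Lemma eq_cdf_measure (R : realType) (m1 m2 : probability R R) :
  (forall x : R, m1 `]-oo, x]%classic = m2 `]-oo, x]%classic) ->
  forall A, measurable A -> m1 A = m2 A.
Proof.
move=> m12; apply: (@measure_unique _ _ _ (@RGenOInfty.G R)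
  (fun n => `](- n%:R)%R, +oo[%classic)).
- exact: RGenOInfty.measurableE.
- move=> _ _ [x ->] [y ->]; exists (Num.max x y).
  by apply/seteqP; split=> z /=; rewrite !in_itv/= !andbT gt_max => /andP.
- by move=> n; exists (- n%:R)%R.
- rewrite -subTset => x _; exists (Num.bound x) => //=.
  by rewrite in_itv/= andbT ltrNl unstable.ltrNbound.
- move=> _ [x ->]; rewrite -setCitvl.
  apply: (etrans (probability_setC m1 (measurable_itv _))).
  rewrite m12; apply: esym; exact: (probability_setC m2 (measurable_itv _)).
- move=> k; apply: (@le_lt_trans _ _ 1); last by rewrite ltry.
  exact: (probability_le1 m1 (measurable_itv _)).
Qed.

Section independent_law.
Context d (T : measurableType d) (R : realType) (P : probability T R).
Context (X Y : {RV P >-> R}).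
Hypothesis indep : independent_RV X Y.

(** Independence fixes the joint law on rectangles, so it is the product measure; Tonelli does the
    rest. *)
Lemma integral_independent (h : R * R -> \bar R) :
  measurable_fun setT h -> (forall z, 0 <= h z) ->
  \int[P]_w h (X w, Y w) =
  \int[distribution P X]_x \int[distribution P Y]_y h (x, y).
Proof.
move=> mh h0.
have mXY : measurable_fun setT (fun w => (X w, Y w)).
  exact: measurable_fun_pair.
rewrite -(ge0_integral_pushforward mXY P measurableT mh) ?preimage_setT//.
rewrite -(fubini_tonelli1 h) //.
apply: eq_measure_integral => A mA _; symmetry.
exact: product_measure_unique.
Qed.

End independent_law.

(** The test event is {V < W}, which lies in the sigma-algebra of [X]. There W - V is positive with
    integral at most 0, so the event is null. *)
Lemma ae_le_of_integral_le d (T : measurableType d) (R : realType)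
    (P : probability T R) d' (T' : measurableType d') (X : T -> T')
    (mX : measurable_fun setT X) (W V : T -> R) :
  measurable_fun [set: g_sigma_algebra_preimageType X] W ->
  measurable_fun [set: g_sigma_algebra_preimageType X] V ->
  P.-integrable setT (EFin \o W) -> P.-integrable setT (EFin \o V) ->
  (forall A, g_sigma_algebra_preimage X A ->
    \int[P]_(w in A) (W w)%:E <= \int[P]_(w in A) (V w)%:E) ->
  {ae P, forall w, (W w <= V w)%R}.
Proof.
move=> mW mV iW iV WV.
pose A := [set w | (V w < W w)%R].
have XA : g_sigma_algebra_preimage X A.
  have := measurable_fun_ltr mV mW measurableT (I : measurable [set true]).
  by rewrite setTI.
have mA : measurable A.
  have [B mB <-] := XA.
  exact: mX.
have iWA : P.-integrable A (EFin \o W) by apply: integrableS iW.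
have iVA : P.-integrable A (EFin \o V) by apply: integrableS iV.
have := WV _ XA; rewrite -sube_le0 -integralB//.
have iWV := integrableB mA iWA iVA.
move=> le0.
have : \int[P]_(w in A) `|(W w)%:E - (V w)%:E| = 0.
  rewrite (eq_integral (fun w => (W w)%:E - (V w)%:E)); last first.
    by move=> w; rewrite inE => Aw; rewrite gee0_abs//= lee_fin subr_ge0 ltW.
  apply/eqP; rewrite eq_le le0/=.
  by apply: integral_ge0 => w Aw; rewrite /= lee_fin subr_ge0 ltW.
move/(ae_eq_integral_abs _ mA (measurable_int P iWV)).
apply: filterS => w /= h; rewrite leNgt; apply/negP => Vw.
by have [/eqP] := h Vw; rewrite subr_eq0 gt_eqF.
Qed.

(** * Existence and uniqueness of the root alpha *)

Section alpha_root.
Local Open Scope ring_scope.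
Context {R : realType} (a b p : R).
Hypotheses (p1 : 1 < p) (a0 : 0 < a) (ab : a <= b).

Let p0 : 0 < p. Proof. have := p1; lra. Qed.

(** Intermediate value theorem in the variable t = alpha^(1/p). *)
Lemma alpha_root_exists : exists2 alpha : R, 0 <= alpha <= 1 &
  a * (p - 1 + alpha) = p * b * alpha `^ p^-1.
Proof.
pose f t := a * (p - 1 + t `^ p) - p * b * t.
(* At [t0] the terms a(p-1) and p b t cancel, leaving f(t0) = a t0^p >= 0, whereas f(1) = p(a - b)
   <= 0. As [t0 > 0], continuity of the power is needed only at positive points. *)
pose t0 := a * (p - 1) / (p * b).
have b0 : 0 < b by have := a0; have := ab; lra.
have pb0 : 0 < p * b by rewrite mulr_gt0.
have t00 : 0 < t0 by rewrite divr_gt0// mulr_gt0// subr_gt0.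
have t01 : t0 <= 1.
  rewrite ler_pdivrMr// mul1r; have := p1; have := ab; have := a0; nra.
have cf : {within `[t0, 1], continuous f}.
  apply: continuous_in_subspaceT => t /set_mem.
  rewrite /= in_itv/= => /andP[tt _].
  have tp : 0 < t by exact: lt_le_trans tt.
  apply: cvgB; last by apply: cvgMr; exact: cvg_id.
  apply: cvgMr; apply: cvgD; first exact: cvg_cst.
  exact: powR_continuous.
have ft0 : 0 <= f t0.
  have -> : f t0 = a * t0 `^ p.
    by rewrite /f [p * b * t0]mulrC divfK ?gt_eqF// mulrDr addrAC subrr add0r.
  by rewrite mulr_ge0 ?powR_ge0// ltW.
have f1 : f 1 <= 0.
  by rewrite /f powR1 subrK mulr1 mulrC subr_le0 ler_pM2l.
have [|t + ft] := IVT t01 cf (v := 0).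
  by rewrite ge_min f1 orbT le_max ft0.
rewrite in_itv/= => /andP[tt t1].
have tp : 0 <= t by rewrite ltW// (lt_le_trans t00).
exists (t `^ p).
2: by rewrite powRK//; apply/eqP; rewrite -subr_eq0; apply/eqP.
have E1 q : 1 `^ q = 1 :> R by rewrite powR1.
rewrite powR_ge0/= -[leRHS](E1 p).
by apply: ge0_ler_powR; rewrite ?nnegrE ?(ltW p0).
Qed.

(** For roots alpha < beta with p-th roots s < t, subtraction gives a(beta - alpha) = p b (t - s).
    But [powR_sub_lt] gives a(beta - alpha) < p a (t - s) <= p b (t - s). *)
Lemma alpha_root_unique (alpha beta : R) :
  0 <= alpha <= 1 -> a * (p - 1 + alpha) = p * b * alpha `^ p^-1 ->
  0 <= beta <= 1 -> a * (p - 1 + beta) = p * b * beta `^ p^-1 ->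
  alpha = beta.
Proof.
wlog ab' : alpha beta / alpha < beta => [wh|].
  move=> al alE be beE; have [h|h|//] := ltgtP alpha beta; first exact: wh.
  by apply/esym/wh.
move=> /andP[al0 al1] alE /andP[be0 be1] beE; exfalso.
have pV0 : 0 < p^-1 by rewrite invr_gt0.
have lt : alpha `^ p^-1 < beta `^ p^-1 by rewrite gt0_ltr_powR ?nnegrE.
have le1 : beta `^ p^-1 <= 1.
  have E1 q : 1 `^ q = 1 :> R by rewrite powR1.
  rewrite -[leRHS](E1 p^-1).
  by apply: ge0_ler_powR; rewrite ?nnegrE ?(ltW pV0).
have := powR_sub_lt p1 (powR_ge0 _ _) lt le1; rewrite !powRVK// => h.
set t := beta `^ p^-1 in lt le1 h beE; set s := alpha `^ p^-1 in lt le1 h alE.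
have h1 : a * (beta - alpha) < a * (p * (t - s)) by rewrite ltr_pM2l.
have h2 : a * (p * (t - s)) <= b * (p * (t - s)).
  by rewrite ler_wpM2r// mulr_ge0 ?subr_ge0 ?ltW.
lra.
Qed.

End alpha_root.

(** * The conditional expectation is dominated by Phi(X) *)

Section conditional_mean.
Context d (T : measurableType d) (R : realType) (P : probability T R).
Context (X Y : {RV P >-> R}) (psi : R -> R).
Hypothesis indep : independent_RV X Y.
Hypothesis eq_law : forall A, measurable A ->
  distribution P Y A = distribution P X A.
Hypothesis mpsi : measurable_fun setT psi.
Let mu : probability R R := distribution P X.
Let g x := `|psi x|%R.
Hypothesis ig : mu.-integrable setT (EFin \o g).

Let g0 x : (0 <= g x)%R. Proof. exact: normr_ge0. Qed.

Let mg : measurable_fun setT g.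
Proof. exact: measurableT_comp. Qed.

Let le_set : set (R * R) := [set z | (z.2 <= z.1)%R].

Let mle_set : measurable le_set.
Proof.
have := measurable_fun_ler (@measurable_snd _ _ R R) (@measurable_fst _ _ R R)
  measurableT (I : measurable [set true]).
by rewrite setTI.
Qed.

Let mPhi : measurable_fun setT (partial_mean mu g).
Proof.
by apply: nondecreasing_measurable => // s t; exact: partial_mean_nd.
Qed.

(** This identifies Phi(X) as E(|psi(Y)| 1[Y <= X] | X): under the product law the inner integral
    over y <= x is Phi(x). *)
Lemma integral_preimage_le (B : set R) : measurable B ->
  \int[P]_(w in X @^-1` B) (g (Y w) * \1_[set w | (Y w <= X w)%R] w)%:E =
  \int[P]_(w in X @^-1` B) (partial_mean mu g (X w))%:E.
Proof.
move=> mB.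
pose h (z : R * R) : \bar R := (\1_B z.1 * (g z.2 * \1_le_set z))%:E.
have mh : measurable_fun setT h.
  apply/measurable_EFinP; apply: measurable_funM.
    by apply: (measurableT_comp (measurable_indic _) measurable_fst).
  apply: measurable_funM; first exact: measurableT_comp mg measurable_snd.
  exact: measurable_indic.
have h0 z : 0 <= h z by rewrite lee_fin !mulr_ge0.
transitivity (\int[P]_w h (X w, Y w)).
  rewrite integral_mkcond; apply: eq_integral => w _.
  rewrite patchE /h /= !indicE; case: ifPn => /=.
    by rewrite inE /= => Bw; rewrite (mem_set Bw) mul1r.
  by rewrite notin_setE /= => Bw; rewrite memNset// mul0r.
rewrite (integral_independent indep mh h0).
transitivity (\int[mu]_x (\1_B x * partial_mean mu g x)%:E).
  apply: eq_integral => x _.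
  (* The inner integral is over the law of [Y], which equals [mu], the law of [X]. *)
  rewrite (eq_measure_integral mu); last by move=> A mA _; exact: eq_law.
  rewrite EFinM fineK; last first.
    by apply: integrable_fin_num => //; exact: integrableS ig.
  under eq_integral do rewrite /h /= EFinM.
  rewrite ge0_integralZl_EFin//=; last 2 first.
  - by move=> y _; rewrite lee_fin mulr_ge0.
  - apply/measurable_EFinP; apply: measurable_funM => //.
    apply: (measurableT_comp (measurable_indic mle_set)).
    exact: measurable_fun_pair.
  congr (_ * _); rewrite [RHS]integral_mkcond; apply: eq_integral => y _.
  rewrite patchE indicE /le_set; case: ifPn.
    by rewrite inE/= in_itv/= => yx; rewrite mem_set//= mulr1.
  by rewrite notin_setE/= in_itv/= => yx; rewrite memNset//= mulr0.
rewrite ge0_integral_distribution; last 2 first.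
- by apply/measurable_EFinP; apply: measurable_funM.
- by move=> x; rewrite lee_fin mulr_ge0// partial_mean_ge0.
rewrite [RHS]integral_mkcond; apply: eq_integral => w _.
rewrite patchE /= indicE; case: ifPn.
  by rewrite inE /= => Bw; rewrite (mem_set Bw) mul1r.
by rewrite notin_setE /= => Bw; rewrite memNset// mul0r.
Qed.

(** Both [W] and [- W] are compared with Phi(X) on events of [X]; the triangle inequality and
    [integral_preimage_le] bound both integrals at once. *)
Lemma condexp_le_partial_mean (W : T -> R) :
  is_condexp X (fun w => psi (Y w) * \1_[set w | (Y w <= X w)%R] w)%R W ->
  {ae P, forall w, (`|W w| <= partial_mean mu g (X w))%R}.
Proof.
move=> [mW iW WZ].
pose Z w := (psi (Y w) * \1_[set w | (Y w <= X w)%R] w)%R.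
have mX : measurable_fun setT X by [].
have sX A : g_sigma_algebra_preimage X A -> measurable A.
  by move=> [B mB <-]; exact: mX.
have mV : measurable_fun [set: g_sigma_algebra_preimageType X]
    (partial_mean mu g \o X).
  move=> _ B mB; exists (partial_mean mu g @^-1` B) => //.
  by rewrite -[X in measurable X]setTI; exact: mPhi.
(* Phi is bounded by the full mean of g. *)
have iV : P.-integrable setT (EFin \o (partial_mean mu g \o X)).
  apply: (@le_integrable _ _ _ P _ measurableT _
      (EFin \o cst (\int[mu]_x g x)%R)) => //.
  - exact/measurable_EFinP/measurableT_comp.
  - move=> w _ /=; rewrite lee_fin.
    rewrite !ger0_norm ?partial_mean_ge0 ?Rintegral_ge0//.
    rewrite fine_le ?integrable_fin_num//; first exact: integrableS ig.
    apply: ge0_subset_integral => //; first exact/measurable_EFinP.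
    by move=> x _; rewrite lee_fin.
  - exact: finite_measure_integrable_cst.
have mle : measurable [set w | (Y w <= X w)%R].
  have mY : measurable_fun setT Y by [].
  have := measurable_fun_ler mY mX measurableT (I : measurable [set true]).
  by rewrite setTI.
have mZ : measurable_fun setT Z.
  apply: measurable_funM; last exact: measurable_indic.
  exact: (measurableT_comp mpsi).
have ZV A : g_sigma_algebra_preimage X A ->
    `|\int[P]_(w in A) (W w)%:E| <=
    \int[P]_(w in A) (partial_mean mu g (X w))%:E.
  move=> XA; rewrite WZ//; have [B mB <-] := XA; rewrite setTI.
  rewrite -integral_preimage_le//.
  have mXB : measurable (X @^-1` B) by apply: sX; exists B => //; rewrite setTI.
  apply: (le_trans (le_abse_integral P mXB _)).
    exact/measurable_EFinP/measurable_funTS.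
  rewrite le_eqVlt; apply/orP; left; apply/eqP/eq_integral => w _.
  by rewrite /= normrM [X in (_ * X)%R]ger0_norm.
have h1 : {ae P, forall w, (W w <= (partial_mean mu g \o X) w)%R}.
  apply: (ae_le_of_integral_le mX) => // A XA.
  exact: le_trans (lee_abs _) (ZV _ XA).
have h2 : {ae P, forall w, (- W w <= (partial_mean mu g \o X) w)%R}.
  apply: (ae_le_of_integral_le mX) => //.
  - exact: measurableT_comp.
  - exact: integrableN iW.
  - move=> A XA; under eq_integral do rewrite EFinN.
  rewrite integralN; last first.
    have iWA : P.-integrable A (EFin \o W).
      by apply: integrableS iW => //; exact: sX.
    exact: (integrable_add_def (sX _ XA) iWA).
  by apply: (le_trans _ (ZV _ XA)); rewrite -abseN lee_abs.
apply: filterS2 h1 h2 => w /= h1 h2.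
by rewrite ler_norml h1 andbT lerNl.
Qed.

End conditional_mean.

(** * Passage from the random variables to their common law *)

Lemma fine_integral_EFin d (T : measurableType d) (R : realType)
    (m : {measure set T -> \bar R}) (f : T -> R) :
  m.-integrable setT (EFin \o f) ->
  \int[m]_x (f x)%:E = (\int[m]_x f x)%R%:E.
Proof. by move=> mf; rewrite fineK//; exact: integrable_fin_num. Qed.

(* MathComp-Analysis.  The first conjunct says that alpha is well defined; it
   needs psi to be nonzero on a set of positive probability.  In the second
   one, the constraints on alpha and on the conditional expectation W are only
   imposed when they make sense, namely for psi(Y) p-integrable, respectively
   psi(Y) 1[Y <= X] integrable; otherwise E(|psi(Y)|^p) = +oo. *)
Theorem theorem2p1 (d : measure_display) (T : measurableType d) (R : realType)
    (P : probability T R) (X Y : {RV P >-> R}) (F psi : R -> R) (p : R)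
    (indepXY : independent_RV X Y)
    (cdfX : forall x : R, cdf X x = (F x)%:E)
    (cdfY : forall x : R, cdf Y x = (F x)%:E)
    (mpsi : measurable_fun [set: R] psi)
    (psi_neq0 : exists y : R, psi y <> 0%R)
    (p_gt1 : (1 < p)%R) :
  (~ {ae P, forall w, psi (Y w) = 0%R} ->
    'E_P[(fun w => `|psi (Y w)| `^ p)%R] < +oo ->
    exists! alpha : R, is_alpha P p (psi \o Y) alpha)
  /\
  (forall (alpha : R) (W : T -> R),
    (0 <= alpha <= 1)%R ->
    ('E_P[(fun w => `|psi (Y w)| `^ p)%R] < +oo ->
      is_alpha P p (psi \o Y) alpha) ->
    (P.-integrable [set: T]
        (fun w => (psi (Y w) * \1_[set w | (Y w <= X w)%R] w)%:E) ->
      is_condexp X (fun w => psi (Y w) * \1_[set w | (Y w <= X w)%R] w)%R W) ->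
    ('E_P[(fun w => `|W w / F (X w)| `^ p)%R]) `^ p^-1
      <= (p / (p - 1 + alpha))%:E
         * ('E_P[(fun w => `|psi (Y w)| `^ p)%R]) `^ p^-1).
Proof.
pose mu : probability R R := distribution P X.
have eq_law A : measurable A -> distribution P Y A = mu A.
  by apply: eq_cdf_measure => x; exact: (etrans (cdfY x) (esym (cdfX x))).
have FE x : dfun mu x = F x by exact: (congr1 fine (cdfX x)).
pose g x := `|psi x|%R.
have mg : measurable_fun setT g by exact: measurableT_comp.
have g0 x : (0 <= g x)%R by exact: normr_ge0.
have mY : measurable_fun setT Y by [].
have EE (h : R -> R) : measurable_fun setT h -> (forall x, (0 <= h x)%R) ->
    'E_P[(fun w => h (Y w))] = \int[mu]_x (h x)%:E.
  move=> mh h0; rewrite unlock.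
  rewrite -(@ge0_integral_distribution _ _ _ _ _ P Y (EFin \o h)); last 2 first.
  - exact/measurable_EFinP.
  - by move=> y; rewrite lee_fin.
  by apply: eq_measure_integral => A mA _; exact: eq_law.
have mgp : measurable_fun setT (fun x => g x `^ p)%R.
  exact: (measurableT_comp (measurable_powR p)).
have Ep : 'E_P[(fun w => `|psi (Y w)| `^ p)%R] = \int[mu]_x (g x `^ p)%:E.
  by rewrite -EE// => x; exact: powR_ge0.
have E1 : 'E_P[(fun w => `|psi (Y w)|)%R] = \int[mu]_x (g x)%:E by rewrite -EE.
have p0 : (0 < p)%R by lra.
have igpP : 'E_P[(fun w => `|psi (Y w)| `^ p)%R] < +oo ->
    mu.-integrable setT (EFin \o (fun x => g x `^ p)%R).
  rewrite Ep => oo; apply/integrableP; split; first exact/measurable_EFinP.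
  by under eq_integral do rewrite /= ger0_norm ?powR_ge0//.
(* With a finite p-th moment the extended-real equation for [alpha] becomes one between real
   integrals against [mu], as used by [alpha_root_exists] and [hardy_constant]. *)
have alphaP alpha : 'E_P[(fun w => `|psi (Y w)| `^ p)%R] < +oo ->
    is_alpha P p (psi \o Y) alpha <-> (0 <= alpha <= 1)%R /\
    ((\int[mu]_x g x) * (p - 1 + alpha) =
     p * (\int[mu]_x (g x `^ p)) `^ p^-1 * alpha `^ p^-1)%R.
  move=> /igpP igp; have ig := integrable_of_powR p_gt1 mg g0 igp.
  rewrite /is_alpha Ep E1 !fine_integral_EFin// poweR_EFin -!EFinM -EFinB.
  split=> -[al]; first by move=> [] /eqP; rewrite subr_eq0 => /eqP.
  by move=> ->; rewrite subrr.
split=> [psiN0 /[dup] Eoo /igpP igp|alpha W al01 alE condW].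
  have ig := integrable_of_powR p_gt1 mg g0 igp.
  (* If the mean of |psi| were 0, psi(Y) would vanish almost surely. *)
  have a0 : (0 < \int[mu]_x g x)%R.
    rewrite lt_neqAle Rintegral_ge0// andbT eq_sym; apply/eqP => a0.
    apply: psiN0; have mpsiY : measurable_fun setT (EFin \o (psi \o Y)).
      by apply/measurable_EFinP; exact: measurableT_comp.
    have : \int[P]_(w in setT) `|(EFin \o (psi \o Y)) w| = 0.
      rewrite -[RHS]/(0%R%:E) -a0 -fine_integral_EFin// -E1 unlock.
      by apply: eq_integral.
    move=> /(ae_eq_integral_abs _ measurableT mpsiY).
    by apply: filterS => w /= /(_ I) [].
  have ab : (\int[mu]_x g x <= (\int[mu]_x (g x `^ p)) `^ p^-1)%R.
    have A0 := ltW a0; rewrite -[leLHS](powRK p0 A0).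
    apply: ge0_ler_powR; rewrite ?nnegrE ?powR_ge0 ?invr_ge0 ?(ltW p0)//.
      by apply: Rintegral_ge0 => x _; exact: powR_ge0.
    exact: powR_Rintegral_le.
  have [alpha al01 alE] := alpha_root_exists p_gt1 a0 ab.
  exists alpha; split; first exact/alphaP.
  move=> beta /(alphaP _ Eoo)[be01 beE].
  exact: (alpha_root_unique p_gt1 a0 ab).
have q0 : (0 < p - 1 + alpha)%R by have [] := andP al01; lra.
have pV0 : (0 < p^-1)%R by rewrite invr_gt0.
have [Eoo|] := ltP ('E_P[(fun w => `|psi (Y w)| `^ p)%R]) +oo; last first.
  (* Without a p-th moment the right-hand side is a positive constant times +oo. *)
  rewrite leye_eq => /eqP ->; rewrite poweRyr ?gt_eqF//.
  by rewrite gt0_muley ?leey// lte_fin divr_gt0.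
have igp := igpP Eoo; have ig := integrable_of_powR p_gt1 mg g0 igp.
have [_ alphaE] := (alphaP _ Eoo).1 (alE Eoo).
have mle : measurable [set w | (Y w <= X w)%R].
  have mX : measurable_fun setT X by [].
  have := measurable_fun_ler mY mX measurableT (I : measurable [set true]).
  by rewrite setTI.
have ipsi : P.-integrable setT (EFin \o (g \o Y)).
  apply/integrableP; split; first exact/measurable_EFinP/measurableT_comp.
  under eq_integral do rewrite /= normr_id.
  have := E1; rewrite unlock => ->.
  by rewrite fine_integral_EFin// ltry.
have iZ : P.-integrable [set: T]
    (fun w => (psi (Y w) * \1_[set w | (Y w <= X w)%R] w)%:E).
  apply: (le_integrable measurableT _ _ ipsi).
    apply/measurable_EFinP; apply: measurable_funM; last first.
      exact: measurable_indic.
    exact: (measurableT_comp mpsi).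
  move=> w _; rewrite /= lee_fin normrM normr_id.
  by rewrite ler_piMr// ger0_norm// indicE lern1 leq_b1.
have cW := condW iZ.
have Wle := condexp_le_partial_mean indepXY eq_law mpsi ig cW.
have mW : measurable_fun setT W.
  by have [_ /(measurable_int P)/measurable_EFinP] := cW.
have mX : measurable_fun setT X by [].
have F0 x : (0 <= F x)%R by rewrite -FE dfun_ge0.
have mFV : measurable_fun setT (fun x => (F x)^-1)%R.
  apply: measurable_funV_ge0 => //; apply: nondecreasing_measurable => // s t.
  by rewrite -!FE; exact: dfun_nd.
have mH : measurable_fun setT (fun x => (partial_mean mu g x / F x) `^ p)%R.
  apply: (measurableT_comp (measurable_powR p)); apply: measurable_funM => //.
  by apply: nondecreasing_measurable => // s t; exact: partial_mean_nd.
rewrite [in leRHS]Ep.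
(* It remains to compare the p-th moment of W / F(X) with that of H(X), which [Wle] does pointwise
   almost surely after writing the integral of H^p against [mu] over the sample space. *)
apply: le_trans (hardy_constant p_gt1 al01 mg g0 igp alphaE).
apply: gt0_ler_poweR; first exact: ltW.
- rewrite in_itv/= leey andbT unlock.
  by apply: integral_ge0 => w _; rewrite lee_fin powR_ge0.
- rewrite in_itv/= leey andbT.
  by apply: integral_ge0 => x _; rewrite lee_fin powR_ge0.
have -> : \int[mu]_x ((partial_mean mu g x / dfun mu x) `^ p)%:E =
    \int[P]_w ((partial_mean mu g (X w) / F (X w)) `^ p)%:E.
  under eq_integral do rewrite FE.
  rewrite (@ge0_integral_distribution _ _ _ _ _ P X
    (EFin \o (fun x => (partial_mean mu g x / F x) `^ p)%R))//.
  - exact/measurable_EFinP.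
  - by move=> x; rewrite lee_fin powR_ge0.
rewrite unlock; apply: ae_ge0_le_integral => //.
- apply/measurable_EFinP; apply: (measurableT_comp (measurable_powR p)).
  apply: measurableT_comp => //; apply: measurable_funM => //.
  exact: (measurableT_comp mFV mX).
- by move=> w _; rewrite lee_fin powR_ge0.
- by apply/measurable_EFinP; exact: (measurableT_comp mH mX).
apply: filterS Wle => w Ww _ /=; rewrite lee_fin.
apply: ge0_ler_powR; rewrite ?nnegrE ?(ltW p0)//.
  by rewrite divr_ge0// partial_mean_ge0.
by rewrite normrM normfV (ger0_norm (F0 _)) ler_wpM2r// invr_ge0.
Qed.
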